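(* Let $(H,[\cdot,\cdot],\alpha)$ be a Hom-Lie superalgebra with $\alpha$ an automorphism of $H$. Suppose that $H$ is centerless and that $H=H'$, where $H'=[H,H]$. Then for every super-biderivation $\phi:H\times H\to H$ there exists $\delta\in C(H)$ (the centroid of $H$) such that $$\phi(\zeta,\xi)=\alpha^{-1}\delta([\zeta,\xi])\quad\text{for all }\zeta,\xi\in H.$$
   Context: $\mathbb{K}$ is an algebraically closed field of characteristic different from $2$. All vector spaces are over $\mathbb{K}$. For a $\mathbb{Z}_2$-graded space, $|\zeta|\in\mathbb{Z}_2$ denotes the degree of a homogeneous element $\zeta$. Whenever $|\zeta|$ (or $|\phi|$, $|\delta|$) occurs in a formula, the element (or map) is understood to be homogeneous. Hom-Lie superalgebra: a $\mathbb{Z}_2$-graded space $H=H_{\bar 0}\oplus H_{\bar 1}$ with a bilinear bracket $[\cdot,\cdot]$ satisfying $[H_i,H_j]\subseteq H_{i+j}$ and a linear map $\alpha:H\to H$ such that for all homogeneous $\zeta,\xi,\omega\in H$: $[\zeta,\xi]=-(-1)^{|\zeta||\xi|}[\xi,\zeta]$ and $(-1)^{|\zeta||\omega|}[\alpha(\zeta),[\xi,\omega]]+(-1)^{|\omega||\xi|}[\alpha(\omega),[\zeta,\xi]]+(-1)^{|\xi||\zeta|}[\alpha(\xi),[\omega,\zeta]]=0$. ''$\alpha$ is an automorphism'' means $\alpha$ is a degree-preserving linear bijection with $\alpha([\zeta,\xi])=[\alpha(\zeta),\alpha(\xi)]$. $H'=[H,H]$ is the span of all brackets. $H$ is centerless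 if $Z(H)=\{v\in H\mid [H,v]=0\}$ is $\{0\}$. Super-biderivation: a bilinear map $\phi:H\times H\to H$ is homogeneous of degree $s\in\mathbb{Z}_2$ (written $|\phi|=s$) if $\phi(H_i,H_j)\subseteq H_{i+j+s}$ for all $i,j\in\mathbb{Z}_2$. A super-biderivation of degree $s$ is a homogeneous bilinear map $\phi$ of degree $s$ with $\phi(\alpha(\zeta),\alpha(\xi))=\alpha(\phi(\zeta,\xi))$ and, for all homogeneous $\zeta,\xi,\omega\in H$, $\phi(\zeta,\xi)=-(-1)^{|\zeta||\xi|}\phi(\xi,\zeta)$ and $\phi([\zeta,\xi],\alpha(\omega))=(-1)^{|\phi||\zeta|}[\alpha(\zeta),\phi(\xi,\omega)]+(-1)^{|\xi||\omega|}[\phi(\zeta,\omega),\alpha(\xi)]$. $\mathrm{BDer}_s(H)$ is the set of these. The super-biderivations of $H$ are the elements of $\mathrm{BDer}(H)=\mathrm{BDer}_{\bar 0}(H)\oplus\mathrm{BDer}_{\bar 1}(H)$. Centroid: $C_s(H)$ is the set of linear maps $\delta:H\to H$ homogeneous of degree $s$ (i.e. $\delta(H_i)\subseteq H_{i+s}$, $|\delta|=s$) with $\alpha\delta=\delta\alpha$ and $\delta([\zeta,\xi])=(-1)^{|\delta||\zeta|}[\alpha(\zeta),\delta(\xi)]$ for all homogeneous $\zeta$ and all $\xi\in H$. Then $C(H)=C_{\bar 0}(H)\oplus C_{\bar 1}(H)$. *)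

(* Defs.v *)
From HB Require Import structures.
From mathcomp Require Import all_boot all_order all_algebra.

Set Implicit Arguments.
Unset Strict Implicit.
Unset Printing Implicit Defensive.

Import GRing.Theory.
Local Open Scope ring_scope.

(* (-1) ^ (|x| |y|) as a scalar; the product is taken in 'Z_2 and its
   representative 0 or 1 is used as the exponent. *)
Definition ssign (K : fieldType) (i j : 'Z_2) : K := (-1) ^+ (i * j)%R.

Section HomLieSuper.

Variables (K : fieldType) (H : lmodType K).
(* x \in gr i means that x is homogeneous of degree i; 0 has both degrees. *)
Variables (gr : 'Z_2 -> {pred H}).
Variables (br : {bilinear H -> H -> H}) (alpha : {linear H -> H}).

Record is_grading : Prop := IsGrading {
  grading_submod : forall i : 'Z_2, submod_closed (gr i);
  grading_sum : forall x : H,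
    exists x0 x1 : H, [/\ x0 \in gr 0, x1 \in gr 1 & x = x0 + x1];
  grading_direct : forall x : H, x \in gr 0 -> x \in gr 1 -> x = 0
}.

(* alpha is only required to be linear here: evenness and multiplicativity are
   part of is_automorphism. *)
Record is_hom_lie_superalgebra : Prop := IsHomLieSuperalgebra {
  hls_grading : is_grading;
  hls_degree : forall (i j : 'Z_2) (x y : H),
    x \in gr i -> y \in gr j -> br x y \in gr (i + j);
  hls_skew : forall (i j : 'Z_2) (x y : H),
    x \in gr i -> y \in gr j -> br x y = - (ssign K i j *: br y x);
  hls_jacobi : forall (i j k : 'Z_2) (x y z : H),
    x \in gr i -> y \in gr j -> z \in gr k ->
    ssign K i k *: br (alpha x) (br y z)
    + ssign K k j *: br (alpha z) (br x y)
    + ssign K j i *: br (alpha y) (br z x) = 0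
}.

Record is_automorphism : Prop := IsAutomorphism {
  aut_bij : bijective alpha;
  aut_degree : forall (i : 'Z_2) (x : H), x \in gr i -> alpha x \in gr i;
  aut_bracket : forall x y : H, alpha (br x y) = br (alpha x) (alpha y)
}.

Definition in_center (v : H) : Prop := forall x : H, br x v = 0.

Definition centerless : Prop := forall v : H, in_center v -> v = 0.

(* The linear span of all brackets. *)
Definition in_derived (x : H) : Prop :=
  exists (n : nat) (c : 'I_n -> K) (u v : 'I_n -> H),
    x = \sum_(i < n) c i *: br (u i) (v i).

Definition perfect : Prop := forall x : H, in_derived x.

Record super_biderivation_deg (s : 'Z_2) (phi : {bilinear H -> H -> H}) : Prop :=
  SuperBiderivationDeg {
  bder_degree : forall (i j : 'Z_2) (x y : H),
    x \in gr i -> y \in gr j -> phi x y \in gr (i + j + s);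
  bder_alpha : forall x y : H, phi (alpha x) (alpha y) = alpha (phi x y);
  bder_skew : forall (i j : 'Z_2) (x y : H),
    x \in gr i -> y \in gr j -> phi x y = - (ssign K i j *: phi y x);
  bder_leibniz : forall (i j k : 'Z_2) (x y z : H),
    x \in gr i -> y \in gr j -> z \in gr k ->
    phi (br x y) (alpha z)
    = ssign K s i *: br (alpha x) (phi y z)
      + ssign K j k *: br (phi x z) (alpha y)
}.

(* Not necessarily homogeneous: a sum of an even and an odd one. *)
Definition super_biderivation (phi : {bilinear H -> H -> H}) : Prop :=
  exists phi0 phi1 : {bilinear H -> H -> H},
    [/\ super_biderivation_deg 0 phi0, super_biderivation_deg 1 phi1
      & forall x y : H, phi x y = phi0 x y + phi1 x y].

Record centroid_deg (s : 'Z_2) (delta : {linear H -> H}) : Prop :=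
  CentroidDeg {
  cent_degree : forall (i : 'Z_2) (x : H), x \in gr i -> delta x \in gr (i + s);
  cent_alpha : forall x : H, alpha (delta x) = delta (alpha x);
  cent_bracket : forall (i : 'Z_2) (x y : H), x \in gr i ->
    delta (br x y) = ssign K s i *: br (alpha x) (delta y)
}.

Definition centroid (delta : {linear H -> H}) : Prop :=
  exists delta0 delta1 : {linear H -> H},
    [/\ centroid_deg 0 delta0, centroid_deg 1 delta1
      & forall x : H, delta x = delta0 x + delta1 x].

End HomLieSuper.

(* Main.v *)
(* Put l x y = alpha^-1 [x, y] and psi = alpha^-1 phi for a homogeneous phi of
   degree s.  Then l is an ordinary Lie superbracket, psi an ordinary
   super-biderivation of l.  Writing signs loosely:
   - Expanding psi (l x u) (l y v) in two ways shows that
     f(x, y; u, v) = l (psi x y) (l u v) - l (l x y) (psi u v) is symmetric under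
     y <-> v, while it is skew under x <-> y and u <-> v; hence f = 0.
   - So if sum l x_i y_i = 0 then sum psi x_i y_i kills l H H = H and vanishes;
     gam (l x y) = psi x y defines a linear map with l (gam x) y = l x (gam y).
   - Let E x y = gam (l x y) - l (gam x) y.  The Jacobi identity makes
     l (E x y) z alternating, and the Leibniz rule gives
     E (l x y) z = - 2 l (E x y) z.  Hence l (l (E x y) z) w is alternating in
     four variables and equals its own opposite after exchanging (x, y) with
     (z, w), so it is 0, and E = 0 because the center is trivial.
   Then delta = alpha gam is the required element of the centroid. *)
Require Import Defs.
From HB Require Import structures.
From mathcomp Require Import all_boot all_order all_algebra.
From mathcomp Require Import boolp.

Set Implicit Arguments.
Unset Strict Implicit.
Unset Printing Implicit Defensive.

Import GRing.Theory.
Local Open Scope ring_scope.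

(* [abel] proves identities between sums of signed atoms by comparing the
   integer coefficients of the atoms. *)
Inductive zexpr : Type :=
  | ZVar of nat | ZZero | ZAdd of zexpr & zexpr | ZOpp of zexpr.

Fixpoint zeval (V : zmodType) (e : seq V) (t : zexpr) : V :=
  match t with
  | ZVar n => e`_n
  | ZZero => 0
  | ZAdd t1 t2 => zeval e t1 + zeval e t2
  | ZOpp t1 => - zeval e t1
  end.

Fixpoint zcoef (t : zexpr) (k : nat) : int :=
  match t with
  | ZVar n => (k == n)%:Z
  | ZZero => 0
  | ZAdd t1 t2 => zcoef t1 k + zcoef t2 k
  | ZOpp t1 => - zcoef t1 k
  end.

Lemma zeval_coef (V : zmodType) (e : seq V) (t : zexpr) :
  zeval e t = \sum_(k < size e) e`_k *~ zcoef t k.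
Proof.
elim: t => [n||t1 IH1 t2 IH2|t1 IH1] /=.
- have [ltn|gen] := ltnP n (size e).
    rewrite (bigD1 (Ordinal ltn)) //= eqxx mulr1z big1 ?addr0 // => k.
    by rewrite -val_eqE /= => /negPf ->; rewrite mulr0z.
  (* An index outside [e] evaluates to the default 0, and no term of the sum carries it. *)
  rewrite nth_default // big1 // => k _.
  by rewrite ltn_eqF ?mulr0z // (leq_trans (ltn_ord k) gen).
- by rewrite big1.
- by rewrite IH1 IH2 -big_split; apply: eq_bigr => k _ /=; rewrite mulrzDr.
- by rewrite IH1 -sumrN; apply: eq_bigr => k _ /=; rewrite mulrNz.
Qed.

Lemma zeval_eq (V : zmodType) (e : seq V) (t1 t2 : zexpr) :
  all (fun k => zcoef t1 k == zcoef t2 k) (iota 0 (size e)) ->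
  zeval e t1 = zeval e t2.
Proof.
move/allP=> eq12; rewrite !zeval_coef; apply: eq_bigr => k _.
by rewrite (eqP (eq12 _ _)) // mem_iota /= add0n.
Qed.

Ltac zmem a e :=
  lazymatch e with
  | nil => constr:(false)
  | a :: _ => constr:(true)
  | _ :: ?e' => zmem a e'
  end.

Ltac zindex a e :=
  lazymatch e with
  | a :: _ => constr:(0%N)
  | _ :: ?e' => let n := zindex a e' in constr:(S n)
  end.

Ltac zatoms x e :=
  lazymatch x with
  | ?a + ?b => let e' := zatoms a e in zatoms b e'
  | - ?a => zatoms a e
  | 0 => e
  | _ => lazymatch zmem x e with true => e | false => constr:(x :: e) end
  end.

Ltac zreify x e :=
  lazymatch x with
  | ?a + ?b =>
      let ta := zreify a e in let tb := zreify b e in constr:(ZAdd ta tb)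
  | - ?a => let ta := zreify a e in constr:(ZOpp ta)
  | 0 => constr:(ZZero)
  | _ => let n := zindex x e in constr:(ZVar n)
  end.

Ltac abel :=
  lazymatch goal with
  | |- @eq ?V ?x ?y =>
      let e := zatoms x (@nil V) in
      let e := zatoms y e in
      let tx := zreify x e in
      let ty := zreify y e in
      change (zeval e tx = zeval e ty);
      apply: zeval_eq; vm_compute; reflexivity
  end.


Ltac signs :=
  rewrite /= ?(expr0, expr1, scale1r, scaleN1r, scaleNr, scalerN, opprK, opprD) /=.

(** * Ordinary Lie superalgebras and their super-biderivations *)

Section LieSuperalgebra.

Variables (K : fieldType) (V : lmodType K) (gr : bool -> {pred V}).
Variable l : {bilinear V -> V -> V}.

Hypothesis two_inj : forall v : V, v + v = 0 -> v = 0.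
Hypothesis gr_submod : forall i, submod_closed (gr i).
Hypothesis gr_sum : forall x, exists x0 x1 : V,
  [/\ x0 \in gr false, x1 \in gr true & x = x0 + x1].
Hypothesis gr_direct : forall x, x \in gr false -> x \in gr true -> x = 0.
Hypothesis l_degree : forall i j x y,
  x \in gr i -> y \in gr j -> l x y \in gr (i (+) j).
Hypothesis l_skew : forall i j x y,
  x \in gr i -> y \in gr j -> l x y = - ((-1) ^+ (i && j) *: l y x).
Hypothesis l_jacobi : forall i j k x y z,
  x \in gr i -> y \in gr j -> z \in gr k ->
  l (l x y) z = l x (l y z) + (-1) ^+ (j && k) *: l (l x z) y.

Lemma l_jacobi_r i j k x y z :
  x \in gr i -> y \in gr j -> z \in gr k ->
  l x (l y z) = l (l x y) z + (-1) ^+ (i && j) *: l y (l x z).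
Proof.
move=> xi yj zk; rewrite (l_jacobi xi yj zk) (l_skew (l_degree xi zk) yj).
by case: i xi => _; case: j yj => _; case: k zk => _; signs; abel.
Qed.

Variables (s : bool) (psi : {bilinear V -> V -> V}).

Hypothesis psi_degree : forall i j x y,
  x \in gr i -> y \in gr j -> psi x y \in gr (i (+) j (+) s).
Hypothesis psi_skew : forall i j x y,
  x \in gr i -> y \in gr j -> psi x y = - ((-1) ^+ (i && j) *: psi y x).
Hypothesis psi_leibniz : forall i j k x y z,
  x \in gr i -> y \in gr j -> z \in gr k ->
  psi (l x y) z = (-1) ^+ (s && i) *: l x (psi y z)
    + (-1) ^+ (j && k) *: l (psi x z) y.

Lemma psi_leibniz_r i j k x y z :
  x \in gr i -> y \in gr j -> z \in gr k ->
  psi x (l y z) = l (psi x y) z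
    + (-1) ^+ ((s (+) i) && j) *: l y (psi x z).
Proof.
move=> xi yj zk; rewrite (psi_skew xi (l_degree yj zk)) (psi_leibniz yj zk xi).
rewrite (psi_skew yj xi) (psi_skew zk xi).
rewrite !(linearNl, linearNr, linearZl_LR, linearZr_LR) /=.
by clear; case: i; case: j; case: k; case: s; signs; abel.
Qed.

(** * Exchanging [psi] and [l] across a bracket *)

(** The sign is the Koszul sign of moving [psi], of degree [s], past [x] and [y]. *)
Definition defect i j x y u v : V :=
  l (psi x y) (l u v) - (-1) ^+ (s && (i (+) j)) *: l (l x y) (psi u v).

(** Leaves an identity of differences for [abel]; using [esym] on the known equation covers the
    cases where the overall sign flips. *)
Lemma subr_eq_tr (x y z t : V) : x = y -> z - t = x - y -> z = t.
Proof. by move=> -> /eqP; rewrite subrr subr_eq0 => /eqP. Qed.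

(* Expand [psi (l x u) (l y v)] first in the right and first in the left
   argument. *)
Lemma defect_swap24 i j p q x y u v :
  x \in gr i -> y \in gr j -> u \in gr p -> v \in gr q ->
  defect i j x y u v =
    (-1) ^+ ((j && p) (+) (j && q) (+) (p && q)) *: defect i q x v u y.
Proof.
move=> xi yj up vq.
have := psi_leibniz xi up (l_degree yj vq).
rewrite (psi_leibniz_r (l_degree xi up) yj vq) (psi_leibniz_r xi yj vq).
rewrite (psi_leibniz_r up yj vq) (psi_leibniz xi up yj) (psi_leibniz xi up vq).
rewrite !(linearDl, linearDr, linearZl_LR, linearZr_LR).
rewrite (l_jacobi xi (psi_degree up yj) vq).
rewrite (l_jacobi (psi_degree xi yj) up vq).
rewrite (l_jacobi_r yj xi (psi_degree up vq)).
rewrite (l_jacobi_r yj (psi_degree xi vq) up).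
rewrite (l_skew yj xi) (l_skew yj up) /defect.
rewrite !(linearNl, linearNr, linearZl_LR, linearZr_LR) /=.
clear; case: i; case: j; case: p; case: q; case: s; signs => E.
all: first [ by apply: (subr_eq_tr E); abel
           | by apply: (subr_eq_tr (esym E)); abel ].
Qed.

Lemma defect_skew12 i j x y u v : x \in gr i -> y \in gr j ->
  defect i j x y u v = - ((-1) ^+ (i && j) *: defect j i y x u v).
Proof.
move=> xi yj; rewrite /defect (psi_skew xi yj) (l_skew xi yj).
rewrite !(linearNl, linearNr, linearZl_LR, linearZr_LR) /=.
by clear; case: i; case: j; case: s; signs; abel.
Qed.

Lemma defect_skew34 i j p q x y u v : u \in gr p -> v \in gr q ->
  defect i j x y u v = - ((-1) ^+ (p && q) *: defect i j x y v u).
Proof.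
move=> up vq; rewrite /defect (psi_skew up vq) (l_skew up vq).
rewrite !(linearNl, linearNr, linearZl_LR, linearZr_LR) /=.
by clear; case: i; case: j; case: p; case: q; case: s; signs; abel.
Qed.

(* All transpositions are conjugate, but [defect] is skew under (12) and
   symmetric under (24). *)
Lemma defect_eq0 i j p q x y u v :
  x \in gr i -> y \in gr j -> u \in gr p -> v \in gr q -> defect i j x y u v = 0.
Proof.
move=> xi yj up vq; apply: two_inj.
(* Since (24)(34) is a 3-cycle, applying (24) and (34) alternately three times each restores the
   arguments, and the three skew signs leave [d = - d]. *)
have := defect_swap24 xi yj up vq.
rewrite (defect_skew34 i q x v up yj) (defect_swap24 xi vq yj up).
rewrite (defect_skew34 i p x u yj vq) (defect_swap24 xi up vq yj).
rewrite (defect_skew34 i j x y vq up); move: (defect i j x y u v) => d.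
clear; case: j; case: p; case: q; signs => E.
all: first [ by apply: (subr_eq_tr E); abel
           | by apply: (subr_eq_tr (esym E)); abel ].
Qed.

Lemma l_psi i j x y u v : x \in gr i -> y \in gr j ->
  l (psi x y) (l u v) = (-1) ^+ (s && (i (+) j)) *: l (l x y) (psi u v).
Proof.
move=> xi yj; apply/eqP; rewrite -subr_eq0; apply/eqP; rewrite -/(defect i j x y u v).
have defectD a b c d : defect i j x y (a + b) (c + d) =
    defect i j x y a c + defect i j x y a d + defect i j x y b c + defect i j x y b d.
  rewrite /defect !(linearDl, linearDr) /= !scalerDr.
  by abel.
have [u0 [u1 [gu0 gu1 ->]]] := gr_sum u; have [v0 [v1 [gv0 gv1 ->]]] := gr_sum v.
rewrite defectD (defect_eq0 xi yj gu0 gv0) (defect_eq0 xi yj gu0 gv1).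
by rewrite (defect_eq0 xi yj gu1 gv0) (defect_eq0 xi yj gu1 gv1) !addr0.
Qed.

Lemma gr0 i : 0 \in gr i.
Proof. by have [] := gr_submod i. Qed.

Lemma grP i a x y : x \in gr i -> y \in gr i -> a *: x + y \in gr i.
Proof. by have [_] := gr_submod i; apply. Qed.

Lemma grZ i a x : x \in gr i -> a *: x \in gr i.
Proof. by move=> xi; rewrite -[_ *: _]addr0 grP ?gr0. Qed.

Lemma grD i x y : x \in gr i -> y \in gr i -> x + y \in gr i.
Proof. by move=> xi yi; rewrite -[x]scale1r grP. Qed.

Lemma grB i x y : x \in gr i -> y \in gr i -> x - y \in gr i.
Proof. by move=> xi yi; rewrite -scaleN1r addrC grP. Qed.

(** * Factoring [psi] through the bracket *)

Hypothesis l_centerless : forall v, (forall x, l x v = 0) -> v = 0.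
Hypothesis l_perfect_ind : forall P : V -> Prop,
  P 0 -> (forall x y, P x -> P y -> P (x + y)) -> (forall x y, P (l x y)) ->
  forall x, P x.

Lemma l_perfect_ind_hom (P : V -> Prop) :
  P 0 -> (forall x y, P x -> P y -> P (x + y)) ->
  (forall i j x y, x \in gr i -> y \in gr j -> P (l x y)) -> forall x, P x.
Proof.
move=> P0 PD Pl; apply: l_perfect_ind => // x y.
have [x0 [x1 [gx0 gx1 ->]]] := gr_sum x; have [y0 [y1 [gy0 gy1 ->]]] := gr_sum y.
rewrite linearDl !linearDr; apply: (PD _ _ (PD _ _ _ _) (PD _ _ _ _)).
- exact: Pl gx0 gy0.
- exact: Pl gx0 gy1.
- exact: Pl gx1 gy0.
- exact: Pl gx1 gy1.
Qed.

Lemma l_center_hom i v : v \in gr i ->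
  (forall j x, x \in gr j -> l v x = 0) -> v = 0.
Proof.
move=> vi v0; apply: l_centerless => x.
have [x0 [x1 [gx0 gx1 ->]]] := gr_sum x.
rewrite linearDl (l_skew gx0 vi) (l_skew gx1 vi) (v0 _ _ gx0) (v0 _ _ gx1).
by rewrite !scaler0 oppr0 addr0.
Qed.

(* The relation between [\sum_i l (x i) (y i)] and [\sum_i psi (x i) (y i)],
   all summands being homogeneous of the same degree. *)
Inductive graph (k : bool) : V -> V -> Prop :=
  | Graph0 : graph k 0 0
  | GraphD i j x y z w : x \in gr i -> y \in gr j -> i (+) j = k ->
      graph k z w -> graph k (l x y + z) (psi x y + w).

Lemma graph_add k z w z' w' :
  graph k z w -> graph k z' w' -> graph k (z + z') (w + w').
Proof.
move=> gzw gz'w'; elim: gzw => [|i j x y {}z {}w xi yj ijk _ IH].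
  by rewrite !add0r.
by rewrite -!addrA; apply: (GraphD xi yj ijk IH).
Qed.

Lemma graph_scale k a z w : graph k z w -> graph k (a *: z) (a *: w).
Proof.
elim=> [|i j x y {}z {}w xi yj ijk _ IH]; first by rewrite !scaler0; constructor.
by rewrite !scalerDr -!linearZl_LR /=; apply: (GraphD (grZ a xi) yj ijk IH).
Qed.

Lemma graph_degree k z w : graph k z w -> z \in gr k /\ w \in gr (k (+) s).
Proof.
elim=> [|i j x y {}z {}w xi yj <- _ [IHz IHw]]; first by split; apply: gr0.
by split; apply: grD => //; [apply: l_degree | apply: psi_degree].
Qed.

(** All summands have total degree [k], so the signs from [l_psi] agree and factor out. *)
Lemma graph_l_psi k z w u v : graph k z w ->
  l w (l u v) = (-1) ^+ (s && k) *: l z (psi u v).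
Proof.
elim=> [|i j x y {}z {}w xi yj <- _ IH]; first by rewrite !linear0l scaler0.
by rewrite !linearDl scalerDr IH (l_psi u v xi yj).
Qed.

(** By [graph_l_psi], [w] kills every bracket, hence everything by perfectness; being homogeneous,
    it is then central. *)
Lemma graph_fun0 k w : graph k 0 w -> w = 0.
Proof.
move=> g0w; apply: (l_center_hom (graph_degree g0w).2) => j x _.
elim/l_perfect_ind: x => [|x y x0 y0|x y]; first exact: linear0r.
  by rewrite linearDr x0 y0 addr0.
by rewrite (graph_l_psi x y g0w) linear0l scaler0.
Qed.

(** The two degrees are kept apart because [graph_l_psi] needs a common sign. *)
Definition sum_graph (z w : V) : Prop := exists z0 z1 w0 w1 : V,
  [/\ graph false z0 w0, graph true z1 w1, z = z0 + z1 & w = w0 + w1].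

Lemma sum_graph_linear a z w z' w' : sum_graph z w -> sum_graph z' w' ->
  sum_graph (a *: z + z') (a *: w + w').
Proof.
move=> [z0 [z1 [w0 [w1 [g0 g1 -> ->]]]]] [z0' [z1' [w0' [w1' [g0' g1' -> ->]]]]].
exists (a *: z0 + z0'), (a *: z1 + z1'), (a *: w0 + w0'), (a *: w1 + w1').
by split; rewrite ?scalerDr 1?addrACA //; apply: graph_add => //; apply: graph_scale.
Qed.

Lemma sum_graph_l i j x y : x \in gr i -> y \in gr j ->
  sum_graph (l x y) (psi x y).
Proof.
move=> xi yj; have gxy := GraphD xi yj erefl (Graph0 _).
rewrite !addr0 in gxy; have g0 k := Graph0 k.
case: (i (+) j) gxy => gxy.
  by exists 0, (l x y), 0, (psi x y); rewrite !add0r.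
by exists (l x y), 0, (psi x y), 0; rewrite !addr0.
Qed.

Lemma sum_graph_total z : exists w, sum_graph z w.
Proof.
elim/l_perfect_ind_hom: z => [|x y [w gxw] [w' gyw']|i j x y xi yj].
- by exists 0, 0, 0, 0, 0; rewrite addr0; split=> //; constructor.
- by exists (1 *: w + w'); rewrite -[x]scale1r; apply: sum_graph_linear.
- by exists (psi x y); apply: sum_graph_l xi yj.
Qed.

(** The component of [z] in the other degree is 0 by directness, so its partner vanishes by
    [graph_fun0]. *)
Lemma sum_graph_hom k z w : z \in gr k -> sum_graph z w -> graph k z w.
Proof.
move=> zk [z0 [z1 [w0 [w1 [g0 g1 ez ->]]]]]; rewrite {}ez in zk *.
have [[gz0 _] [gz1 _]] := (graph_degree g0, graph_degree g1).
case: k zk => zk.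
  have z00 : z0 = 0 by apply: gr_direct => //; rewrite -(addrK z1 z0) grB.
  by rewrite z00 in g0 *; rewrite (graph_fun0 g0) !add0r.
have z10 : z1 = 0.
  by apply: gr_direct => //; rewrite -(addrK z0 z1) grB // addrC.
by rewrite z10 in g1 *; rewrite (graph_fun0 g1) !addr0.
Qed.

Lemma sum_graph_fun z w w' : sum_graph z w -> sum_graph z w' -> w = w'.
Proof.
move=> gzw gzw'; have := sum_graph_linear (-1) gzw gzw'.
rewrite !scaleN1r addNr => /(sum_graph_hom (gr0 false))/graph_fun0/eqP.
by rewrite addrC subr_eq0 => /eqP.
Qed.

Lemma gamma_exists : exists gam : {linear V -> V},
  [/\ forall i x, x \in gr i -> gam x \in gr (i (+) s),
      forall x y, gam (l x y) = psi x y
    & forall i x y, x \in gr i ->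
        l (gam x) y = (-1) ^+ (s && i) *: l x (gam y)].
Proof.
have [gam gamP] : exists gam : {linear V -> V}, forall z, sum_graph z (gam z).
  (* The relation is total and single-valued: choice gives a function, and uniqueness makes it
     linear. *)
  pose g z := projT1 (cid (sum_graph_total z)).
  have gP z : sum_graph z (g z) := projT2 (cid (sum_graph_total z)).
  have g_lin : linear g.
    by move=> a x y; apply: sum_graph_fun (gP _) _; apply: sum_graph_linear.
  by exists (HB.pack_for {linear V -> V} g (GRing.isLinear.Build K V V _ g g_lin)).
have gam_l x y : gam (l x y) = psi x y.
  have [x0 [x1 [gx0 gx1 ->]]] := gr_sum x.
  have [y0 [y1 [gy0 gy1 ->]]] := gr_sum y.
  have gl i j a b : a \in gr i -> b \in gr j -> gam (l a b) = psi a b.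
    by move=> ai bj; apply: sum_graph_fun (gamP _) (sum_graph_l ai bj).
  rewrite !linearDl !linearDr !raddfD /=.
  rewrite (gl _ _ _ _ gx0 gy0) (gl _ _ _ _ gx1 gy0).
  by rewrite (gl _ _ _ _ gx0 gy1) (gl _ _ _ _ gx1 gy1).
exists gam; split=> // [i x xi|i x y xi].
  exact: (graph_degree (sum_graph_hom xi (gamP x))).2.
(* On a bracket [y], the symmetry of [gam] is exactly [graph_l_psi]. *)
elim/l_perfect_ind: y => [|y z IHy IHz|y z].
- by rewrite linear0r [gam 0]raddf0 linear0r scaler0.
- by rewrite [gam (y + z)]raddfD !linearDr /= IHy IHz scalerDr.
- by rewrite gam_l; apply: graph_l_psi; apply: sum_graph_hom xi (gamP x).
Qed.

(** * The map [gam] commutes with brackets *)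

Variable gam : {linear V -> V}.
Hypothesis gam_degree : forall i x, x \in gr i -> gam x \in gr (i (+) s).
Hypothesis gam_l : forall x y, gam (l x y) = psi x y.
Hypothesis gam_sym : forall i x y, x \in gr i ->
  l (gam x) y = (-1) ^+ (s && i) *: l x (gam y).

(** This is [E] of the overview. *)
Definition dev x y : V := gam (l x y) - l (gam x) y.

Lemma dev_degree i j x y :
  x \in gr i -> y \in gr j -> dev x y \in gr (i (+) j (+) s).
Proof.
move=> xi yj; apply: grB; first exact: gam_degree (l_degree xi yj).
by rewrite addbAC; apply: l_degree => //; apply: gam_degree.
Qed.

(** Moving [gam] across by [gam_sym] and then using [l_skew] shows that [l (gam x) y] is itself
    skew. *)
Lemma dev_skew i j x y : x \in gr i -> y \in gr j ->
  dev x y = - ((-1) ^+ (i && j) *: dev y x).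
Proof.
move=> xi yj; rewrite /dev (gam_sym y xi) (l_skew xi (gam_degree yj)) (l_skew xi yj).
rewrite [gam (- _)]raddfN /= [gam (_ *: _)]linearZ /=.
by clear; case: i; case: j; case: s; signs; abel.
Qed.

(** After [gam_sym] and Jacobi, up to signs, [l (dev x y) z] consists of [l x (l y (gam z))], skew
    in [y], [z], and of [l (l (gam x) z) y] and [l (l (gam x) y) z], which the swap exchanges. *)
Lemma l_dev_skew23 i j k x y z : x \in gr i -> y \in gr j -> z \in gr k ->
  l (dev x y) z = - ((-1) ^+ (j && k) *: l (dev x z) y).
Proof.
move=> xi yj zk; rewrite /dev !linearBl.
rewrite (gam_sym z (l_degree xi yj)) (gam_sym y (l_degree xi zk)).
rewrite (l_jacobi xi yj (gam_degree zk)) (l_jacobi xi zk (gam_degree yj)).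
have eqz : l x (gam z) = (-1) ^+ (s && i) *: l (gam x) z.
  by rewrite (gam_sym z xi) scalerA -signr_addb addbb expr0 scale1r.
have eqy : l x (gam y) = (-1) ^+ (s && i) *: l (gam x) y.
  by rewrite (gam_sym y xi) scalerA -signr_addb addbb expr0 scale1r.
rewrite eqz eqy (l_skew zk (gam_degree yj)) (gam_sym z yj).
rewrite !(linearZl_LR, linearZr_LR, linearNr) /=.
by clear; case: i; case: j; case: k; case: s; signs; abel.
Qed.

(** The Leibniz rule and the Jacobi identity for [gam x], [y], [z] share the term
    [l (gam x) (l y z)]. Eliminating it leaves [- l (dev x y) z] and its swap in [y], [z], which are
    equal by [l_dev_skew23]. *)
Lemma dev_l i j k x y z : x \in gr i -> y \in gr j -> z \in gr k ->
  dev (l x y) z = - (l (dev x y) z + l (dev x y) z).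
Proof.
move=> xi yj zk; rewrite {2}(l_dev_skew23 xi yj zk) /dev !linearBl /=.
rewrite [gam (l (l x y) z)]gam_l (psi_leibniz xi yj zk) -!gam_l.
rewrite -(gam_sym (l y z) xi).
rewrite (l_jacobi (gam_degree xi) yj zk).
by clear; case: j; case: k; signs; abel.
Qed.

Lemma ldev_l i j k x y z w : x \in gr i -> y \in gr j -> z \in gr k ->
  l (dev (l x y) z) w = - (l (l (dev x y) z) w + l (l (dev x y) z) w).
Proof. by move=> xi yj zk; rewrite (dev_l xi yj zk) linearNl linearDl. Qed.

(** This is [l_dev_skew23] at [l x y]: [dev_l] puts a factor -2 on both sides, which [two_inj]
    cancels. *)
Lemma lldev_skew34 i j k p x y z w :
  x \in gr i -> y \in gr j -> z \in gr k -> w \in gr p ->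
  l (l (dev x y) z) w = - ((-1) ^+ (k && p) *: l (l (dev x y) w) z).
Proof.
move=> xi yj zk wp.
have := l_dev_skew23 (l_degree xi yj) zk wp.
rewrite (ldev_l w xi yj zk) (ldev_l z xi yj wp) => E.
apply/eqP; rewrite -addr_eq0; apply/eqP/two_inj.
apply: (subr_eq_tr (esym E)).
by clear; case: k; case: p; signs; abel.
Qed.

(* [l (l (dev x y) z) w] is skew under all transpositions, so invariant under
   (13)(24); comparing [dev_l] with the Jacobi identity shows that it also
   changes sign there. *)
Lemma lldev_eq0 i j k p x y z w :
  x \in gr i -> y \in gr j -> z \in gr k -> w \in gr p ->
  l (l (dev x y) z) w = 0.
Proof.
move=> xi yj zk wp.
have := l_dev_skew23 zk wp (l_degree xi yj).
rewrite (dev_skew zk (l_degree xi yj)) (l_jacobi_r (dev_degree zk wp) xi yj).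
rewrite (l_skew xi (l_degree (dev_degree zk wp) yj)) (lldev_skew34 zk wp yj xi).
rewrite !(linearNl, linearZl_LR) /= (ldev_l w xi yj zk).
rewrite (l_dev_skew23 zk wp xi) (dev_skew zk xi) !(linearNl, linearZl_LR) /=.
rewrite (lldev_skew34 xi zk wp yj) (l_dev_skew23 xi zk yj).
rewrite !(linearNl, linearZl_LR) /= => E.
(* With T the left side of the goal, [E] says 2T = -2T up to a common sign, so 4T = 0. *)
apply/two_inj/two_inj; move: E.
clear; case: i; case: j; case: k; case: p; case: s; signs => E.
all: first [ by apply: (subr_eq_tr E); abel
           | by apply: (subr_eq_tr (esym E)); abel ].
Qed.

Lemma gam_centroid x y : gam (l x y) = l (gam x) y.
Proof.
have dev0 i j a b : a \in gr i -> b \in gr j -> dev a b = 0.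
  (* Triviality of the center is used twice, to strip the two outer brackets. *)
  move=> ai bj; apply: (l_center_hom (dev_degree ai bj)) => k c ck.
  apply: (l_center_hom (l_degree (dev_degree ai bj) ck)) => p d dp.
  exact: lldev_eq0 ai bj ck dp.
have gl i j a b : a \in gr i -> b \in gr j -> gam (l a b) = l (gam a) b.
  by move=> ai bj; apply/eqP; rewrite -subr_eq0; apply/eqP; apply: dev0 ai bj.
have [x0 [x1 [gx0 gx1 ->]]] := gr_sum x; have [y0 [y1 [gy0 gy1 ->]]] := gr_sum y.
rewrite [gam (x0 + x1)]raddfD /= !linearDl !linearDr !raddfD /=.
rewrite (gl _ _ _ _ gx0 gy0) (gl _ _ _ _ gx1 gy0).
by rewrite (gl _ _ _ _ gx0 gy1) (gl _ _ _ _ gx1 gy1).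
Qed.

End LieSuperalgebra.

(** * Untwisting the Hom structure by the inverse of [alpha] *)

Section HomLieSuperalgebra.

Variables (K : fieldType) (H : lmodType K) (gr : 'Z_2 -> {pred H}).
Variables (br : {bilinear H -> H -> H}) (alpha : {linear H -> H}).
Hypothesis charK : 2%N \notin [pchar K].
Hypothesis HL : is_hom_lie_superalgebra gr br alpha.
Hypothesis Haut : is_automorphism gr br alpha.
Hypothesis Hcenterless : centerless br.
Hypothesis Hperfect : perfect br.
Variable alphaV : {linear H -> H}.
Hypothesis alphaK : cancel alpha alphaV.
Hypothesis alphaVK : cancel alphaV alpha.

(** With boolean degrees, case analysis makes every sign compute. *)
Let grb (b : bool) : {pred H} := gr b%:R.

Lemma Z2_bool (i : 'Z_2) : exists b : bool, i = b%:R.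
Proof.
by case: i => [[|[|//]] lti]; [exists false | exists true]; apply: val_inj.
Qed.

Lemma Z2_addb (b c : bool) : b%:R + c%:R = (b (+) c)%:R :> 'Z_2.
Proof. by case: b; case: c; apply: val_inj. Qed.

Lemma ssign_bool (b c : bool) : ssign K b%:R c%:R = (-1) ^+ (b && c).
Proof. by case: b; case: c. Qed.

Definition comp_bilinear (g : {linear H -> H}) (b : {bilinear H -> H -> H}) x y :=
  g (b x y).

Fact comp_bilinear_subproof g b :
  bilinear_for *:%R *:%R (comp_bilinear g b).
Proof.
by split=> u a x y; rewrite /comp_bilinear ?linearPl ?linearPr linearP.
Qed.

HB.instance Definition _ g b :=
  bilinear_isBilinear.Build K H H H *:%R *:%R (comp_bilinear g b)
    (comp_bilinear_subproof g b).

Let l : {bilinear H -> H -> H} := comp_bilinear alphaV br.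

Let lE x y : l x y = alphaV (br x y). Proof. by []. Qed.

Let alpha_inj : injective alpha. Proof. exact: can_inj alphaK. Qed.

(** Each nested bracket of a twisted identity is thus [alpha] applied twice to an untwisted one, and
    injectivity removes both. *)
Let br_alpha x y : br (alpha x) (alpha y) = alpha (alpha (l x y)).
Proof. by rewrite -(aut_bracket Haut) alphaVK. Qed.

Let two_inj (v : H) : v + v = 0 -> v = 0.
Proof.
rewrite -mulr2n -scaler_nat => /eqP; rewrite scaler_eq0 => /orP[|/eqP //].
by move: charK; rewrite inE /= => /negPf ->.
Qed.

Let grb_sum x : exists x0 x1 : H,
  [/\ x0 \in grb false, x1 \in grb true & x = x0 + x1].
Proof. exact: grading_sum (hls_grading HL) x. Qed.

Let grb_direct x : x \in grb false -> x \in grb true -> x = 0.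
Proof. exact: grading_direct (hls_grading HL) x. Qed.

Let grb_submod b : submod_closed (grb b).
Proof. exact: grading_submod (hls_grading HL) _. Qed.

(** The image under [alpha] of the unwanted component of [alphaV x] lies in both degrees, so it is
    0. *)
Let alphaV_degree b x : x \in grb b -> alphaV x \in grb b.
Proof.
move=> xb; have [x0 [x1 [g0 g1 ex]]] := grb_sum (alphaV x).
have ga c y : y \in grb c -> alpha y \in grb c by apply: aut_degree Haut _ _.
have xE : x = alpha x0 + alpha x1 by rewrite -linearD -ex alphaVK.
case: b xb => xb.
  suff x00 : x0 = 0 by rewrite ex x00 add0r.
  apply: alpha_inj; rewrite linear0; apply: grb_direct; first exact: ga.
  rewrite -(addrK (alpha x1) (alpha x0)) -xE.
  exact: grB grb_submod _ _ _ xb (ga _ _ g1).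
suff x10 : x1 = 0 by rewrite ex x10 addr0.
apply: alpha_inj; rewrite linear0; apply: grb_direct; last exact: ga.
rewrite -(addrK (alpha x0) (alpha x1)) [alpha x1 + _]addrC -xE.
exact: grB grb_submod _ _ _ xb (ga _ _ g0).
Qed.

Let l_degree i j x y : x \in grb i -> y \in grb j -> l x y \in grb (i (+) j).
Proof.
move=> xi yj; apply: alphaV_degree; rewrite /grb -Z2_addb.
exact: hls_degree HL _ _ _ _ xi yj.
Qed.

Let l_skew i j x y : x \in grb i -> y \in grb j ->
  l x y = - ((-1) ^+ (i && j) *: l y x).
Proof.
move=> xi yj; rewrite lE (hls_skew HL xi yj) ssign_bool.
by rewrite raddfN /= [alphaV (_ *: _)]linearZ.
Qed.

Let l_jacobi i j k x y z :
  x \in grb i -> y \in grb j -> z \in grb k ->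
  l (l x y) z = l x (l y z) + (-1) ^+ (j && k) *: l (l x z) y.
Proof.
move=> xi yj zk.
have : (-1) ^+ (i && k) *: l x (l y z) + (-1) ^+ (k && j) *: l z (l x y)
    + (-1) ^+ (j && i) *: l y (l z x) = 0.
  apply/alpha_inj/alpha_inj; rewrite !linear0 -(hls_jacobi HL xi yj zk) !ssign_bool.
  rewrite -[br y z]alphaVK -[br x y]alphaVK -[br z x]alphaVK -!lE !br_alpha.
  by rewrite !linearD /= !linearZ.
rewrite (l_skew (l_degree xi yj) zk) (l_skew (l_degree xi zk) yj).
rewrite (l_skew xi zk) !(linearNr, linearZr_LR) /=.
clear; case: i; case: j; case: k; signs => E.
all: first [ by apply: (subr_eq_tr E); abel
           | by apply: (subr_eq_tr (esym E)); abel ].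
Qed.

Let l_centerless v : (forall x, l x v = 0) -> v = 0.
Proof.
move=> v0; apply: Hcenterless => x.
by rewrite -[br x v]alphaVK -lE v0 linear0.
Qed.

Let l_perfect_ind (P : H -> Prop) :
  P 0 -> (forall x y, P x -> P y -> P (x + y)) -> (forall x y, P (l x y)) ->
  forall x, P x.
Proof.
(* Expanding [alpha x] rather than [x] lets [alphaV] turn each [br] into [l]; scalars are absorbed
   into the left argument. *)
move=> P0 PD Pl x; have [n [c [u [v ex]]]] := Hperfect (alpha x).
rewrite -[x]alphaK ex linear_sum /=; apply: big_ind => // i _.
by rewrite linearZ /= -lE -linearZl_LR.
Qed.

Lemma centroid_of_biderivation (s : bool) (phi : {bilinear H -> H -> H}) :
  super_biderivation_deg gr br alpha s%:R phi ->
  exists delta : {linear H -> H}, centroid_deg gr br alpha s%:R delta /\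
    forall x y, delta (br x y) = alpha (phi x y).
Proof.
move=> Dphi; pose psi : {bilinear H -> H -> H} := comp_bilinear alphaV phi.
have psiE x y : psi x y = alphaV (phi x y) by [].
have phiE x y : phi x y = alpha (psi x y) by rewrite psiE alphaVK.
have phi_alpha x y : phi (alpha x) (alpha y) = alpha (alpha (psi x y)).
  by rewrite (bder_alpha Dphi) phiE.
have psi_degree i j x y :
    x \in grb i -> y \in grb j -> psi x y \in grb (i (+) j (+) s).
  move=> xi yj; apply: alphaV_degree; rewrite /grb -!Z2_addb.
  exact: bder_degree Dphi _ _ _ _ xi yj.
have psi_skew i j x y : x \in grb i -> y \in grb j ->
    psi x y = - ((-1) ^+ (i && j) *: psi y x).
  move=> xi yj; rewrite psiE (bder_skew Dphi xi yj) ssign_bool.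
  by rewrite raddfN /= [alphaV (_ *: _)]linearZ.
have psi_leibniz i j k x y z : x \in grb i -> y \in grb j -> z \in grb k ->
    psi (l x y) z = (-1) ^+ (s && i) *: l x (psi y z)
      + (-1) ^+ (j && k) *: l (psi x z) y.
  move=> xi yj zk; apply/alpha_inj/alpha_inj.
  rewrite -phi_alpha lE alphaVK (bder_leibniz Dphi xi yj zk) !ssign_bool.
  by rewrite !phiE !br_alpha !linearD /= !linearZ.
have [gam [gam_degree gam_l gam_sym]] := gamma_exists two_inj grb_submod grb_sum
  grb_direct l_degree l_skew l_jacobi psi_degree psi_skew psi_leibniz
  l_centerless l_perfect_ind.
have gam_c := gam_centroid two_inj grb_submod grb_sum l_degree l_skew l_jacobi
  psi_leibniz l_centerless gam_degree gam_l gam_sym.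
have brE x y : br x y = alpha (l x y) by rewrite lE alphaVK.
(* On brackets [gam] is [psi], which commutes with [alpha] because [phi] does. *)
have gam_alpha x : gam (alpha x) = alpha (gam x).
  elim/l_perfect_ind: x => [|x y IHx IHy|x y]; first by rewrite !linear0.
    by rewrite !linearD /= IHx IHy.
  rewrite gam_l -brE -[br x y]alphaK (aut_bracket Haut) -lE gam_l.
  by apply: alpha_inj; rewrite -phiE phi_alpha.
exists (alpha \o gam : {linear H -> H}); split=> [|x y] /=; last first.
  by rewrite brE gam_alpha gam_l phiE.
split=> [i x|x|i x y] /=; rewrite ?gam_alpha //; have [b ->] := Z2_bool i => xi.
  by apply: aut_degree Haut _ _ _; rewrite Z2_addb; apply: gam_degree.
(* Both sides become [alpha] applied twice to a signed [l x (gam y)]. *)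
rewrite ssign_bool br_alpha brE gam_alpha gam_c (gam_sym _ _ _ xi).
by rewrite !linearZ.
Qed.

End HomLieSuperalgebra.

(** * Assembling the even and odd parts *)

Theorem theorem3p8 (K : closedFieldType) (charK : 2%N \notin [pchar K])
    (H : lmodType K) (gr : 'Z_2 -> {pred H})
    (br : {bilinear H -> H -> H}) (alpha : {linear H -> H})
    (HL : is_hom_lie_superalgebra gr br alpha)
    (Haut : is_automorphism gr br alpha)
    (alphaV : H -> H)
    (alphaK : cancel alpha alphaV) (alphaVK : cancel alphaV alpha)
    (Hcenterless : centerless br) (Hperfect : perfect br)
    (phi : {bilinear H -> H -> H}) (Hphi : super_biderivation gr br alpha phi) :
  exists delta : {linear H -> H},
    centroid gr br alpha delta /\
    forall x y : H, phi x y = alphaV (delta (br x y)).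
Proof.
(* The inverse is given as a bare function; it is linear because [alpha] is. *)
have [g gE] : exists g : {linear H -> H}, g =1 alphaV.
  by exists (HB.pack_for {linear H -> H} alphaV
    (GRing.isLinear.Build K H H _ alphaV (can2_linear alphaK alphaVK))).
have gK : cancel alpha g by move=> x; rewrite gE.
have gVK : cancel g alpha by move=> x; rewrite gE.
have [phi0 [phi1 [D0 D1 phiE]]] := Hphi.
(* The degrees 0 and 1 of ['Z_2] are [false%:R] and [true%:R] by conversion. *)
have [d0 [C0 d0E]] :=
  centroid_of_biderivation charK HL Haut Hcenterless Hperfect gK gVK
    (s := false) D0.
have [d1 [C1 d1E]] :=
  centroid_of_biderivation charK HL Haut Hcenterless Hperfect gK gVK
    (s := true) D1.
exists (d0 \+ d1 : {linear H -> H}); split; first by exists d0, d1.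
by move=> x y; rewrite /= d0E d1E -linearD -phiE alphaK.
Qed.
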